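(* When the large-sample approximation $q(z)$ (defined in the context) is used for the $1-\alpha$ quantile, the variability in the power, i.e. the standard error $\mathrm{SE}[\mathcal{P}_R]=\sqrt{\mathrm{Var}[\mathcal{P}_R]}$ taken over the imbalances in the unobserved response component, decreases monotonically, as the attainable $R$ increases, to a nonzero constant.
   Context: An experiment uses $R$ allocation vectors $w_1,\dots,w_R\in\{-1,+1\}^n$ and their mirrors $-w_1,\dots,-w_R$. A one-sided randomization test of level $\alpha<1/2$ is run for a positive additive treatment effect $\beta$, and $\gamma=\sqrt{n}\,\beta$ is the sample-size-scaled effect. It is assumed that all pairwise absolute allocation correlations $|w_i^\top w_j|/n$ ($i\neq j$, $i,j\le R$) equal $\rho$, that the observed covariate imbalance is zero, and that the standardized imbalances in the unobserved response component for $w_1,\dots,w_R$ are jointly normal, standard and equicorrelated with correlation $\rho$, so that they can be written $\sqrt{\rho}\,Z_0+\sqrt{1-\rho}\,Z_i$ with $Z_0,Z_1,\dots,Z_R$ i.i.d. standard normal. The treatment effect estimators for the $i$th allocation and for its mirror are $$V_i=\sqrt{\rho}\,Z_0+\sqrt{1-\rho}\,Z_i+\gamma,\qquad V_i^m=-\sqrt{\rho}\,Z_0-\sqrt{1-\rho}\,Z_i+\gamma .$$ $I_i$ is the indicator that $V_i$ beats the $1-\alpha$ quantile from the other $2R-1$ estimators, and $I_i^m$ is the indicator that its mirror $V_i^m$ beats this quantile. The power conditional on the unobserved component is $$\mathcal{P}_R=\frac{1}{2R}\sum_{i=1}^R\left(I_i+I_i^m\right).$$ The large-sample (in $R$) approximation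 replaces the $1-\alpha$ quantile, conditionally on $Z_0=z$, by the fixed quantity $q(z)$ satisfying $$\Phi\left(\frac{\sqrt{\rho}\,z+\rho\gamma-q(z)}{\sqrt{1-\rho}}\right)+\Phi\left(-\frac{\sqrt{\rho}\,z+\rho\gamma+q(z)}{\sqrt{1-\rho}}\right)=2\alpha,$$ where $\Phi$ is the standard normal CDF. The attainable values of $R$ are those for which $2\alpha R$ is a natural number.
   Formalization: The correlation ρ is assumed strictly positive (and below 1): for ρ = 0 the quantile q(z) is constant, the pairs of indicators are independent, and the standard error decreases to zero rather than to a nonzero constant. *)

(* Defs.v *)
From HB Require Import structures.
From mathcomp Require Import all_boot all_order all_algebra.
From mathcomp Require Import all_classical all_reals all_analysis.

Set Implicit Arguments.
Unset Strict Implicit.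
Unset Printing Implicit Defensive.

Import Order.TTheory GRing.Theory Num.Theory.
Import numFieldNormedType.Exports.

Local Open Scope classical_set_scope.
Local Open Scope ring_scope.

(* The product rule over subfamilies is the case B i = setT for the remaining
   indices. *)
Definition mutually_independent (R : realType) (d : measure_display)
    (T : measurableType d) (P : probability T R) (I : finType)
    (X : I -> {RV P >-> R}) : Prop :=
  forall B : I -> set R, (forall i, measurable (B i)) ->
    P (\bigcap_(i in [set: I]) (X i @^-1` B i)) =
    (\prod_(i : I) P (X i @^-1` B i))%E.

Definition standard_normal (R : realType) (d : measure_display)
    (T : measurableType d) (P : probability T R) (X : {RV P >-> R}) : Prop :=
  forall A : set R, measurable A -> distribution P X A = normal_prob 0 1 A.

Definition iid_standard_normal (R : realType) (d : measure_display)
    (T : measurableType d) (P : probability T R) (I : finType)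
    (X : I -> {RV P >-> R}) : Prop :=
  mutually_independent X /\ forall i, standard_normal (X i).

Definition Phi (R : realType) (x : R) : R :=
  fine (normal_prob (0 : R) 1 `]-oo, x]).

Definition std_error (R : realType) (d : measure_display)
    (T : measurableType d) (P : probability T R) (X : T -> R) : R :=
  Num.sqrt (fine 'V_P[X]).

(* q z is the 1 - alpha quantile of the equal mixture of the laws of
   sqrt rho z + sqrt (1 - rho) N + rho gamma and of its opposite, N standard
   normal; the equation determines q z when 0 < alpha < 1 and rho < 1. *)
Definition quantile_equation (R : realType) (alpha rho gamma : R)
    (q : R -> R) : Prop :=
  forall z : R,
    Phi ((Num.sqrt rho * z + rho * gamma - q z) / Num.sqrt (1 - rho)) +
    Phi (- ((Num.sqrt rho * z + rho * gamma + q z) / Num.sqrt (1 - rho)))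
    = 2 * alpha.

(* There are N allocation vectors and their mirrors.  In the family Z, indexed
   by 'I_N.+1, the variable of index ord0 is the common factor and the one of
   index lift ord0 i is specific to the i-th allocation. *)
Section Power.
Variables (R : realType) (T : Type) (N : nat) (rho gamma : R) (q : R -> R).
Variable Z : 'I_N.+1 -> T -> R.

Definition estimator (i : 'I_N) (t : T) : R :=
  Num.sqrt rho * Z ord0 t + Num.sqrt (1 - rho) * Z (lift ord0 i) t + gamma.

Definition mirror_estimator (i : 'I_N) (t : T) : R :=
  - (Num.sqrt rho * Z ord0 t) - Num.sqrt (1 - rho) * Z (lift ord0 i) t + gamma.

Definition beats (i : 'I_N) (t : T) : R := (q (Z ord0 t) < estimator i t)%R%:R.

Definition mirror_beats (i : 'I_N) (t : T) : R :=
  (q (Z ord0 t) < mirror_estimator i t)%R%:R.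

Definition power (t : T) : R :=
  (2 * N%:R)^-1 * \sum_(i < N) (beats i t + mirror_beats i t).

End Power.

Definition attainable (R : realType) (alpha : R) (N : nat) : Prop :=
  (0 < N)%N /\ exists k : nat, 2 * alpha * N%:R = k%:R.

(* Main.v *)
Require Import Defs.
From HB Require Import structures.
From mathcomp Require Import all_boot all_order all_algebra.
From mathcomp Require Import all_classical all_reals all_analysis.
From mathcomp Require Import measurable_realfun ring lra.

Set Implicit Arguments.
Unset Strict Implicit.
Unset Printing Implicit Defensive.

Import Order.TTheory GRing.Theory Num.Theory.
Import numFieldNormedType.Exports.

Local Open Scope classical_set_scope.
Local Open Scope ring_scope.

(* Given Z_0 the pairs (I_i, I_i^m) are i.i.d., so with g = I_1 + I_1^m and
   h(z) = E[g | Z_0 = z] the law of total variance gives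
   Var[P_R] = (Var[h(Z_0)] + E[Var[g | Z_0]] / R) / 4.
   Put a = sqrt rho z + rho gamma, s = sqrt (1 - rho) and 2 alpha = Phi t.  As
   a tends to +oo or -oo, q(z) is asymptotic to |a| - s t, hence h(z) tends to
   Phi (t + (1 - rho) gamma / s) at +oo and to Phi (t + (1 + rho) gamma / s) at
   -oo.  These limits differ, so Var[h(Z_0)] > 0; and g is not constant given
   Z_0 = z as soon as q(z) > gamma, so E[Var[g | Z_0]] > 0. *)

(** * Positivity of integrals and variances of bounded functions *)

Lemma integral_gt0 d (T : measurableType d) (R : realType)
    (mu : {measure set T -> \bar R}) (D : set T) (f : T -> \bar R) :
  measurable D -> measurable_fun D f -> (forall x, D x -> 0 < f x)%E ->
  (0 < mu D)%E -> (0 < \int[mu]_(x in D) f x)%E.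
Proof.
move=> mD mf f0 muD.
rewrite lt_neqAle integral_ge0 ?andbT; last by move=> x Dx; exact/ltW/f0.
apply/eqP => /esym int0.
have : (\int[mu]_(x in D) `|f x| = 0)%E.
  by rewrite -int0; apply: eq_integral => x /[!inE] /f0 /ltW /gee0_abs.
move/(ae_eq_integral_abs mu mD mf) => [N [mN N0 sub]].
have : (mu D <= mu N)%E.
  apply: le_measure; rewrite ?inE// => x Dx; apply: sub => /= /(_ Dx) fx0.
  by have := f0 _ Dx; rewrite fx0 ltxx.
by rewrite N0 leNgt muD.
Qed.

Section BoundedFunctions.
Context d (T : measurableType d) (R : realType) (P : probability T R).
Implicit Types f : T -> R.

Lemma bounded_integrable f (M : R) : measurable_fun setT f ->
  (forall x, `|f x| <= M) -> P.-integrable setT (EFin \o f).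
Proof.
move=> mf fM; apply: measurable_bounded_integrable => //.
  by apply: le_lt_trans (probability_le1 _ _) (ltry _).
by exists M; split; [exact: num_real|move=> x Mx y _; apply: le_trans (ltW Mx)].
Qed.

Lemma Rintegral_gt0 f (M : R) (A : set T) : measurable_fun setT f ->
  (forall x, 0 <= f x <= M) -> measurable A -> (0 < P A)%E ->
  (forall x, A x -> 0 < f x) -> 0 < \int[P]_x f x.
Proof.
move=> mf fM mA PA f0.
have intf : P.-integrable setT (EFin \o f).
  apply: (@bounded_integrable _ M) => // x.
  by have /andP[? ?] := fM x; rewrite ger0_norm.
rewrite -lte_fin fineK ?integrable_fin_num//.
apply: (@lt_le_trans _ _ (\int[P]_(x in A) (f x)%:E)%E).
  apply: integral_gt0 => //.
  by apply/measurable_EFinP; exact: measurable_funTS.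
apply: ge0_subset_integral => //; first exact/measurable_EFinP.
by move=> x _; rewrite lee_fin; have /andP[] := fM x.
Qed.

Lemma Rintegral_cst1 (c : R) : \int[P]_x c = c.
Proof.
rewrite Rintegral_cst// (_ : fine _ = 1) ?mulr1//.
by rewrite (_ : 1 = fine 1%E)// -(probability_setT P).
Qed.

Lemma Rintegral_le_cst f (M : R) : measurable_fun setT f ->
  (forall x, 0 <= f x <= M) -> 0 <= \int[P]_x f x <= M.
Proof.
move=> mf fM; rewrite Rintegral_ge0/=; last by move=> x _; case/andP: (fM x).
rewrite -[leRHS]Rintegral_cst1; apply: le_Rintegral => //.
- apply: (@bounded_integrable _ M) => // x.
  by have /andP[? ?] := fM x; rewrite ger0_norm.
- by apply: (@bounded_integrable _ `|M|).
- by move=> x _; case/andP: (fM x).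
Qed.

(** The centred form yields signs; the expanded form is the one in which variances are computed. *)
Lemma Rintegral_sqr_center f (M : R) : measurable_fun setT f ->
  (forall x, 0 <= f x <= M) ->
  \int[P]_x ((f x - \int[P]_y f y) ^+ 2)
  = \int[P]_x (f x ^+ 2) - (\int[P]_x f x) ^+ 2.
Proof.
move=> mf fM; set m := Rintegral _ _ f.
have intf : P.-integrable setT (EFin \o f).
  apply: (@bounded_integrable _ M) => // x.
  by have /andP[? ?] := fM x; rewrite ger0_norm.
have intf2 : P.-integrable setT (EFin \o (fun x => f x ^+ 2)).
  apply: (@bounded_integrable _ (M ^+ 2)); first exact: measurable_funX.
  move=> x; have /andP[? ?] := fM x.
  rewrite ger0_norm ?sqr_ge0// lerXn2r ?nnegrE//.
  exact: le_trans (_ : f x <= M).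
have intc (c : R) : P.-integrable setT (EFin \o (fun=> c)).
  by apply: (@bounded_integrable _ `|c|).
have intmf : P.-integrable setT (EFin \o (fun x => 2 * m * f x)).
  apply: (@bounded_integrable _ (`|2 * m| * M)) => [|x].
    exact: measurable_funM.
  by have /andP[? ?] := fM x; rewrite normrM ler_wpM2l// ger0_norm.
have int3 : P.-integrable setT (EFin \o (fun x => f x ^+ 2 - 2 * m * f x)).
  apply: (@bounded_integrable _ (M ^+ 2 + `|2 * m| * M)) => [|x].
    apply: measurable_funB => //; first exact: measurable_funX.
    exact: measurable_funM.
  have /andP[f0 f1] := fM x.
  rewrite (le_trans (ler_normB _ _))// lerD//.
    by rewrite ger0_norm ?sqr_ge0// lerXn2r ?nnegrE// (le_trans f0).
  by rewrite normrM (ger0_norm f0) ler_wpM2l.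
transitivity (\int[P]_x ((f x ^+ 2 - 2 * m * f x) + m ^+ 2)).
  by apply: eq_Rintegral => x _; ring.
rewrite RintegralD//.
rewrite RintegralB// RintegralZl// Rintegral_cst1 -/m; ring.
Qed.

(** The mean [m] lies on one side of the level [k]: if [m < k] then [f] differs from [m] on all of
    [B], otherwise on all of [A], and both sets have positive mass. *)
Lemma variance_gt0 f (M k : R) (A B : set T) : measurable_fun setT f ->
  (forall x, 0 <= f x <= M) ->
  measurable A -> (0 < P A)%E -> (forall x, A x -> f x < k) ->
  measurable B -> (0 < P B)%E -> (forall x, B x -> k <= f x) ->
  0 < \int[P]_x (f x ^+ 2) - (\int[P]_x f x) ^+ 2.
Proof.
move=> mf fM mA PA fA mB PB fB; rewrite -(Rintegral_sqr_center mf fM).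
have /andP[m0 mM] := Rintegral_le_cst mf fM.
set m := Rintegral _ _ f in m0 mM *.
have mfm : measurable_fun setT (fun x => (f x - m) ^+ 2).
  by apply: measurable_funX; exact: measurable_funB.
have fmM x : 0 <= (f x - m) ^+ 2 <= M ^+ 2.
  have /andP[f0 f1] := fM x.
  (* [M ^+ 2 - (f x - m) ^+ 2] is a product of two factors, nonnegative because [f x] and [m] both
     lie between 0 and [M]. *)
  by rewrite sqr_ge0/= -subr_ge0 subr_sqr mulr_ge0//; lra.
have sq_gt0 x : f x != m -> 0 < (f x - m) ^+ 2.
  by move=> fm; rewrite lt_neqAle sqr_ge0 andbT eq_sym sqrf_eq0 subr_eq0.
have [mk|km] := ltP m k.
  apply: (Rintegral_gt0 mfm fmM mB PB) => x Bx; apply: sq_gt0.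
  by rewrite gt_eqF// (lt_le_trans mk)// fB.
apply: (Rintegral_gt0 mfm fmM mA PA) => x Ax; apply: sq_gt0.
by rewrite lt_eqF// (lt_le_trans _ km)// fA.
Qed.
End BoundedFunctions.

(** * The standard normal distribution function *)

Section Gaussian.
Variable R : realType.
Implicit Types x y : R.
Local Notation gauss := (normal_prob (0 : R) 1).

Lemma normal_prob_gt0 (A : set R) : measurable A ->
  (0 < lebesgue_measure A)%E -> (0 < gauss A)%E.
Proof.
move=> mA; apply: integral_gt0 => //.
  by apply/measurable_EFinP/measurable_funTS; exact: measurable_normal_pdf.
move=> x _; rewrite lte_fin normal_pdfE ?oner_neq0//.
by rewrite mulr_gt0 ?normal_peak_gt0 ?oner_neq0// expR_gt0.
Qed.

Lemma normal_prob_itv_gt0 x y : x < y -> (0 < gauss `]x, y])%E.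
Proof.
move=> xy; apply: normal_prob_gt0 => //.
by rewrite lebesgue_measure_itv/= lte_fin xy -EFinD lte_fin subr_gt0.
Qed.

Lemma Phi_EFin x : (Phi x)%:E = gauss `]-oo, x].
Proof. by rewrite fineK// fin_num_measure. Qed.

Lemma Phi_subE x y : x <= y -> (Phi y - Phi x)%:E = gauss `]x, y].
Proof.
move=> xy; have -> : gauss `]x, y] = (gauss `]-oo, y] - gauss `]-oo, x])%E.
  have -> : `]-oo, y]%classic = `]-oo, x] `|` `]x, y] :> set R.
    by rewrite -itv_bndbnd_setU// bnd_simp.
  rewrite measureU//=; last first.
    apply/seteqP; split => z //=; rewrite !in_itv/= => -[zx /andP[xz _]].
    by move: (lt_le_trans xz zx); rewrite ltxx.
  by rewrite addeAC subee ?add0e// fin_num_measure.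
by rewrite EFinB !Phi_EFin.
Qed.

Lemma ltr_Phi : {mono @Phi R : x y / x < y}.
Proof.
apply: (leW_mono (le_mono _)) => x y xy.
by rewrite -subr_gt0 -lte_fin Phi_subE ?ltW// normal_prob_itv_gt0.
Qed.

Lemma ler_Phi : {mono @Phi R : x y / x <= y}.
Proof. by apply: le_mono => x y; rewrite ltr_Phi. Qed.

(** The density is at most its peak value, which bounds its integral over []x, y]]. Continuity of
    [Phi] follows. *)
Lemma Phi_lipschitz x y : x <= y -> Phi y - Phi x <= normal_peak 1 * (y - x).
Proof.
move=> xy; rewrite -lee_fin Phi_subE//.
apply: (@le_trans _ _
    (\int[lebesgue_measure]_(z in `]x, y]) (normal_peak (1 : R))%:E)%E).
  apply: ge0_le_integral => //=.
  - by move=> z _; rewrite lee_fin normal_pdf_ge0.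
  - by apply/measurable_EFinP/measurable_funTS; exact: measurable_normal_pdf.
  - by move=> z _; rewrite lee_fin normal_pdf_ub// oner_neq0.
rewrite integral_cst//= lebesgue_measure_itv/= lte_fin.
case: ltP => [_|yx]; first by rewrite -EFinD -EFinM.
by rewrite mule0 lee_fin mulr_ge0 ?normal_peak_ge0// subr_ge0.
Qed.

Lemma continuous_Phi : continuous (@Phi R).
Proof.
move=> x; apply/cvgrPdist_le => /= e e0.
have p0 : 0 < normal_peak (1 : R) by rewrite normal_peak_gt0// oner_neq0.
have H a b : a <= b -> `|a - b| <= e / normal_peak 1 -> `|Phi a - Phi b| <= e.
  move=> ab; rewrite distrC [in X in _ -> X]distrC.
  rewrite !ger0_norm ?subr_ge0 ?ler_Phi//.
  rewrite ler_pdivlMr// mulrC; exact/le_trans/Phi_lipschitz.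
near=> y.
have yx : `|x - y| <= e / normal_peak 1.
  by near: y; apply: cvgr_dist_le => //; rewrite divr_gt0.
have [xy|/ltW yx'] := leP x y; first exact: H.
by rewrite distrC; apply: H; rewrite 1?distrC.
Unshelve. all: end_near. Qed.

(** Under [gauss] the identity is a random variable with distribution function [Phi], so the limits
    of [cdf] at both infinities transfer to [Phi]. *)
Let idR : measurableTypeR R -> R := idfun.
Let measurable_idR : measurable_fun setT idR.
Proof. exact: (@measurable_id _ _ setT). Qed.
#[local] HB.instance Definition _ :=
  isMeasurableFun.Build _ _ _ _ idR measurable_idR.

Lemma cvg_Phi_pinfty : Phi x @[x --> +oo] --> (1 : R).
Proof.
exact: (fine_cvg (@cvg_cdfy1 _ _ _ gauss
  (idR : {mfun measurableTypeR R >-> R}))).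
Qed.

Lemma cvg_Phi_ninfty : Phi x @[x --> -oo] --> (0 : R).
Proof.
exact: (fine_cvg (@cvg_cdfNy0 _ _ _ gauss
  (idR : {mfun measurableTypeR R >-> R}))).
Qed.

Lemma normal_prob_opp_pdf x : normal_pdf (0 : R) 1 (- x) = normal_pdf 0 1 x.
Proof.
by rewrite !normal_pdfE ?oner_neq0// /normal_fun !subr0 sqrrN.
Qed.

(** Reflection exchanges the two half-lines, and the density is even. *)
Lemma normal_prob_itvcy x : gauss `[x, +oo[ = (Phi (- x))%:E.
Proof.
rewrite Phi_EFin /normal_prob ge0_integration_by_substitutionNy; last 2 first.
- apply: continuous_subspaceT => z; apply: continuous_normal_pdf.
  by rewrite oner_neq0.
- by move=> z _; rewrite normal_pdf_ge0.
by apply: eq_integral => z _ /=; rewrite normal_prob_opp_pdf.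
Qed.

Lemma normal_prob_set1 x : gauss [set x] = 0%E.
Proof. by rewrite /normal_prob integral_set1. Qed.

Lemma normal_prob_itvoy x : gauss `]x, +oo[ = (Phi (- x))%:E.
Proof.
rewrite -normal_prob_itvcy -(@setU1itv _ _ _ x false)// measureU//=.
  by rewrite normal_prob_set1 add0e.
by apply/seteqP; split => z //=; rewrite in_itv/= => -[->]; rewrite ltxx.
Qed.

Lemma normal_prob_itvNyo x : gauss `]-oo, x[ = (Phi x)%:E.
Proof.
rewrite Phi_EFin -(@setUitv1 _ _ _ x true)// measureU//=.
  by rewrite normal_prob_set1 adde0.
by apply/seteqP; split => z //=; rewrite in_itv/= => -[+ zx]; rewrite zx ltxx.
Qed.

Lemma Phi_gt0 x : 0 < Phi x.
Proof.
apply: (@le_lt_trans _ _ (Phi (x - 1))); first by rewrite fine_ge0.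
by rewrite ltr_Phi ltrBlDr ltrDl.
Qed.

(** Intermediate values between two points supplied by the limits at infinity. This is what allows
    [2 * alpha] to be written [Phi t]. *)
Lemma Phi_surj (p : R) : 0 < p < 1 -> exists t, Phi t = p.
Proof.
move=> /andP[p0 p1].
have /filter_ex[a /= ap] : \forall a \near -oo, Phi a < p.
  exact: cvgr_lt cvg_Phi_ninfty _ p0.
have /filter_ex[b /= pb] : \forall b \near +oo, p < Phi b.
  exact: cvgr_gt cvg_Phi_pinfty _ p1.
have ab : a <= b by rewrite -ler_Phi ltW// (lt_trans ap).
have [||t _ <-] := @IVT _ (@Phi R) a b p ab.
- by apply: continuous_subspaceT => z; exact: continuous_Phi.
- rewrite ge_min le_max (ltW ap) (ltW pb) orbT//.
- by exists t.
Qed.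
End Gaussian.

(** * Iterated integrals of bounded functions *)

Section BoundedFubini.
Context d1 d2 (T1 : measurableType d1) (T2 : measurableType d2) (R : realType).
Variables (m1 : probability T1 R) (m2 : probability T2 R).
Variables (F : T1 * T2 -> R) (M : R).
Hypothesis mF : measurable_fun setT F.
Hypothesis FM : forall z, 0 <= F z <= M.

(** Bounded sections have finite integrals, so the [fine] hidden in the real integral loses nothing
    and Tonelli's theorem can be used. *)
Let section_integralE x :
  (\int[m2]_y (F (x, y))%:E)%E = (\int[m2]_y F (x, y))%:E.
Proof.
rewrite fineK//; apply: integrable_fin_num => //.
apply: (@bounded_integrable _ _ _ _ _ M) => [|y].
  by apply: measurableT_comp.
by have /andP[? ?] := FM (x, y); rewrite ger0_norm.
Qed.

Lemma measurable_Rintegral_section :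
  measurable_fun setT (fun x => \int[m2]_y F (x, y)).
Proof.
apply/measurable_EFinP.
have := @measurable_fun_fubini_tonelli_F _ _ T1 T2 R m2 (EFin \o F).
have -> : fubini_F m2 (EFin \o F) = EFin \o (fun x => \int[m2]_y F (x, y)).
  by apply/funext => x; rewrite /fubini_F section_integralE.
by apply; [exact/measurable_EFinP|move=> z; rewrite lee_fin; case/andP: (FM z)].
Qed.

Lemma Rintegral_product :
  \int[(m1 \x m2)%E]_z F z = \int[m1]_x \int[m2]_y F (x, y).
Proof.
congr fine; rewrite (fubini_tonelli1 (EFin \o F)); last 2 first.
- exact/measurable_EFinP.
- by move=> z; rewrite lee_fin; case/andP: (FM z).
by apply: eq_integral => x _; rewrite /fubini_F section_integralE.
Qed.
End BoundedFubini.

(** * Joint laws of two and three independent variables *)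

Section JointLaw.
Context d d1 d2 d3 (T : measurableType d) (T1 : measurableType d1)
  (T2 : measurableType d2) (T3 : measurableType d3) (R : realType).
Variable P : probability T R.
Variables (m1 : probability T1 R) (m2 : probability T2 R).
Variable m3 : probability T3 R.
Variables (X : T -> T1) (Y : T -> T2) (W : T -> T3).
Hypothesis mX : measurable_fun setT X.
Hypothesis mY : measurable_fun setT Y.
Hypothesis mW : measurable_fun setT W.

(** A measure that has the product values on rectangles is the product measure; this identifies the
    law of [(X, Y)], and Fubini concludes. *)
Lemma Rintegral_joint (F : T1 * T2 -> R) (M : R) :
  (forall A B, measurable A -> measurable B ->
    P (X @^-1` A `&` Y @^-1` B) = (m1 A * m2 B)%E) ->
  measurable_fun setT F -> (forall z, 0 <= F z <= M) ->
  \int[P]_t F (X t, Y t) = \int[m1]_x \int[m2]_y F (x, y).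
Proof.
move=> XY mF FM; rewrite -(Rintegral_product _ _ mF FM); congr fine.
have mXY : measurable_fun setT (fun t => (X t, Y t)).
  exact: measurable_fun_pair.
pose XYt : {mfun T >-> (T1 * T2)%type} :=
  HB.pack (fun t => (X t, Y t)) (isMeasurableFun.Build _ _ _ _ _ mXY).
rewrite (_ : (\int[P]_t _ = \int[distribution P XYt]_z (F z)%:E)%E);
  last first.
  rewrite ge0_integral_distribution//; first exact/measurable_EFinP.
  by move=> z; rewrite lee_fin; case/andP: (FM z).
apply: eq_measure_integral => C mC _.
by apply/esym/product_measure_unique => //= A B mA mB; rewrite -XY.
Qed.

(** For fixed [C] both sides are finite measures in [D] that agree on rectangles. The uniqueness
    theorem compares with a product of two measures, so the constant [m3 C] is first absorbed into
    the factor [m1] and then taken out again. *)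
Lemma joint_law_pair (C : set T3) : measurable C ->
  (forall A B, measurable A -> measurable B ->
    P (X @^-1` A `&` Y @^-1` B `&` W @^-1` C) = (m1 A * m2 B * m3 C)%E) ->
  forall D, measurable D ->
    P ((fun t => (X t, Y t)) @^-1` D `&` W @^-1` C) = ((m1 \x m2) D * m3 C)%E.
Proof.
move=> mC XYW D mD.
have c0 : 0 <= fine (m3 C) by rewrite fine_ge0.
pose c := NngNum c0.
have cC : m3 C = c%:num%:E by rewrite /= fineK// fin_num_measure.
have mWC : measurable (W @^-1` C).
  by rewrite -[X in measurable X]setTI; exact: mW.
pose XY t := (X t, Y t).
have mXY : measurable_fun setT XY by exact: measurable_fun_pair.
pose m' : {measure set (T1 * T2) -> \bar R} :=
  pushforward (mrestr P mWC) XY.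
pose mc : {finite_measure set T1 -> \bar R} := mscale c m1.
pose mcp : {measure set (T1 * T2) -> \bar R} := mscale c (m1 \x m2)%E.
have e1 : (mc \x m2)%E D = m' mXY D.
  apply: product_measure_unique => // A B mA mB.
  rewrite /m' /mc /= /pushforward /mrestr /mscale /= -muleA muleC -cC -XYW//.
have e2 : (mc \x m2)%E D = mcp D.
  apply: product_measure_unique => // A B mA mB.
  transitivity (c%:num%:E * (m1 A * m2 B))%E; last by rewrite muleA.
  by rewrite -(product_measure1E m1 m2 mA mB).
by rewrite cC muleC -[RHS]/(mcp D) -e2 e1.
Qed.
End JointLaw.

Section TripleLaw.
Context d d1 (T : measurableType d) (T1 : measurableType d1) (R : realType).
Variables (P : probability T R) (mu : probability T1 R).
Variables (X Y W : T -> T1).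
Hypothesis mX : measurable_fun setT X.
Hypothesis mY : measurable_fun setT Y.
Hypothesis mW : measurable_fun setT W.

(** Given [X = x], the variables [g (x, Y)] and [g (x, W)] are independent with the same mean, so
    their product has the square of that mean as conditional expectation. *)
Lemma Rintegral_cond_indep (g : T1 * T1 -> R) (M : R) :
  (forall A B C, measurable A -> measurable B -> measurable C ->
    P (X @^-1` A `&` Y @^-1` B `&` W @^-1` C) = (mu A * mu B * mu C)%E) ->
  measurable_fun setT g -> (forall z, 0 <= g z <= M) ->
  \int[P]_t (g (X t, Y t) * g (X t, W t)) =
  \int[mu]_x ((\int[mu]_y g (x, y)) ^+ 2).
Proof.
move=> XYW mg gM.
have g0 z : 0 <= g z by case/andP: (gM z).
have gleM z : g z <= M by case/andP: (gM z).
have mXY : measurable_fun setT (fun t => (X t, Y t)).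
  exact: measurable_fun_pair.
have mgx x : measurable_fun setT (fun y => g (x, y)) by exact: measurableT_comp.
have intg x : mu.-integrable setT (EFin \o (fun y => g (x, y))).
  by apply: (@bounded_integrable _ _ _ _ _ M) => // y; rewrite ger0_norm.
have h0M x : 0 <= \int[mu]_y g (x, y) <= M by exact: Rintegral_le_cst.
have mh : measurable_fun setT (fun x => \int[mu]_y g (x, y)).
  exact: (measurable_Rintegral_section mu mg gM).
pose F (z : (T1 * T1) * T1) := g z.1 * g (z.1.1, z.2).
have mF : measurable_fun setT F.
  apply: measurable_funM; first exact: measurableT_comp.
  apply: measurableT_comp => //; apply: measurable_fun_pair => //.
  exact: measurableT_comp.
have FM z : 0 <= F z <= M * M by rewrite mulr_ge0//= ler_pM.
have law : forall D C, measurable D -> measurable C ->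
    P ((fun t => (X t, Y t)) @^-1` D `&` W @^-1` C) = ((mu \x mu) D * mu C)%E.
  move=> D C mD mC; apply: (joint_law_pair mX mY mW) => // A B mA mB.
  exact: XYW.
have := Rintegral_joint mXY mW law mF FM; rewrite /F /= => ->.
(* Integrating out [W] first leaves a factor that depends on [X] only; integrating out [Y] then
   produces the second copy of it. *)
transitivity (\int[(mu \x mu)%E]_z (g z * \int[mu]_y g (z.1, y))).
  by apply: eq_Rintegral => z _; rewrite RintegralZl.
rewrite (Rintegral_product mu mu
  (F := fun z => g z * \int[mu]_y g (z.1, y)) (M := M * M)).
- by apply: eq_Rintegral => x _ /=; rewrite RintegralZr.
- by apply: measurable_funM => //; exact: (measurableT_comp mh).
- by move=> z; have /andP[? ?] := h0M z.1; rewrite mulr_ge0//= ler_pM.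
Qed.
End TripleLaw.

(** * Variance of an average with common first and second moments *)

Section AverageVariance.
Context d (T : measurableType d) (R : realType) (P : probability T R).

Lemma Rintegral_sum (I : Type) (r : seq I) (f : I -> T -> R) :
  (forall i, P.-integrable setT (EFin \o f i)) ->
  \int[P]_t (\sum_(i <- r) f i t) = \sum_(i <- r) \int[P]_t f i t.
Proof.
move=> fi; elim: r => [|i r ih].
  by under eq_Rintegral do rewrite big_nil; rewrite big_nil Rintegral_cst1.
under eq_Rintegral do rewrite big_cons.
rewrite big_cons RintegralD// ?ih//.
rewrite [X in integrable _ _ X](_ : _ =
    (fun t => \sum_(j <- r) (f j t)%:E)%E).
  by apply: integrable_sum => // j _; exact: fi.
by apply/funext => t; rewrite /= sumEFin.
Qed.

Lemma fine_variance (X : T -> R) (M : R) : measurable_fun setT X ->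
  (forall t, 0 <= X t <= M) ->
  fine 'V_P[X] = \int[P]_t (X t ^+ 2) - (\int[P]_t X t) ^+ 2.
Proof.
move=> mX XM; rewrite -(Rintegral_sqr_center P mX XM).
by rewrite /variance covariance.unlock expectation.unlock.
Qed.

Lemma variance_average (N : nat) (Y : 'I_N -> T -> R) (M m s c : R) :
  (0 < N)%N ->
  (forall i, measurable_fun setT (Y i)) -> (forall i t, 0 <= Y i t <= M) ->
  (forall i, \int[P]_t Y i t = m) ->
  (forall i, \int[P]_t (Y i t ^+ 2) = s) ->
  (forall i j, i != j -> \int[P]_t (Y i t * Y j t) = c) ->
  fine 'V_P[(fun t => (2 * N%:R)^-1 * \sum_(i < N) Y i t)] =
  4^-1 * ((c - m ^+ 2) + (s - c) / N%:R).
Proof.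
move=> N0 mY YM Ym Ys Yc.
have Y0 i t : 0 <= Y i t by case/andP: (YM i t).
have YleM i t : Y i t <= M by case/andP: (YM i t).
have iY i : P.-integrable setT (EFin \o Y i).
  by apply: (@bounded_integrable _ _ _ _ _ M) => // t; rewrite ger0_norm.
have iYY i j : P.-integrable setT (EFin \o (fun t => Y i t * Y j t)).
  apply: (@bounded_integrable _ _ _ _ _ (M * M)) => [|t].
    exact: measurable_funM.
  by rewrite ger0_norm ?mulr_ge0// ler_pM.
have mS : measurable_fun setT (fun t => \sum_(i < N) Y i t).
  exact: measurable_sum.
have S0 t : 0 <= \sum_(i < N) Y i t by apply: sumr_ge0.
have SM t : \sum_(i < N) Y i t <= N%:R * M.
  apply: le_trans (ler_sum _ (fun i _ => YleM i t)) _.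
  by rewrite sumr_const card_ord mulr_natl.
have k0 : 0 <= (2 * N%:R)^-1 :> R by rewrite invr_ge0 mulr_ge0.
have N0' : (N%:R : R) != 0 by rewrite pnatr_eq0 -lt0n.
rewrite (@fine_variance _ ((2 * N%:R)^-1 * (N%:R * M))); last 2 first.
- exact: measurable_funM.
- by move=> t; rewrite mulr_ge0//= ler_wpM2l.
rewrite RintegralZl//; last first.
  apply: (@bounded_integrable _ _ _ _ _ (N%:R * M)) => // t.
  by rewrite ger0_norm.
rewrite Rintegral_sum//.
under eq_bigr do rewrite Ym.
under eq_Rintegral do rewrite exprMn.
rewrite RintegralZl//; last first.
  apply: (@bounded_integrable _ _ _ _ _ ((N%:R * M) ^+ 2)) => [|t].
    exact: measurable_funX.
  by rewrite ger0_norm ?sqr_ge0// lerXn2r ?nnegrE// (le_trans (S0 t)).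
(* The expanded square has [N] rows, each with one diagonal term [s] and [N - 1] off-diagonal terms
   [c]. *)
have -> : \int[P]_t ((\sum_(i < N) Y i t) ^+ 2) = N%:R * (s + (N%:R - 1) * c).
  transitivity (\int[P]_t (\sum_(i < N) \sum_(j < N) Y i t * Y j t)).
    by apply: eq_Rintegral => t _; rewrite expr2 big_distrlr.
  rewrite Rintegral_sum => [|i]; last first.
    rewrite [X in integrable _ _ X](_ : _ =
        (fun t => \sum_(j < N) (Y i t * Y j t)%:E)%E).
      by apply: integrable_sum => // j _; exact: iYY.
    by apply/funext => t; rewrite /= sumEFin.
  under eq_bigr => i _.
    rewrite Rintegral_sum// (bigD1 i)//=.
    under eq_Rintegral do rewrite -expr2.
    rewrite Ys; under eq_bigr => j ji do rewrite Yc 1?eq_sym//.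
    rewrite sumr_const cardC1 card_ord.
    over.
  rewrite sumr_const card_ord -[LHS]mulr_natl -[c *+ _]mulr_natl.
  by rewrite -subn1 natrB.
by rewrite sumr_const card_ord -[m *+ N]mulr_natl; field.
Qed.
End AverageVariance.

(** * Product rules for two and three members of an independent family *)

Section Independence.
Context (R : realType) d (T : measurableType d) (P : probability T R).
Context (J : finType) (X : J -> {RV P >-> R}).

(** The remaining indices receive [setT], whose preimages have probability 1; since [i], [j], [k]
    are distinct, the nested tests in [D] give each its own set. *)
Lemma mutually_independent3 (i j k : J) (A B C : set R) :
  mutually_independent X -> i != j -> i != k -> j != k ->
  measurable A -> measurable B -> measurable C ->
  (P (X i @^-1` A `&` X j @^-1` B `&` X k @^-1` C) =
   P (X i @^-1` A) * P (X j @^-1` B) * P (X k @^-1` C))%E.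
Proof.
move=> indX ij ik jk mA mB mC.
pose D l := if l == i then A else if l == j then B else
  if l == k then C else setT.
have mD l : measurable (D l) by rewrite /D; do 3 case: ifP => // _.
have Di : D i = A by rewrite /D eqxx.
have Dj : D j = B by rewrite /D eq_sym (negbTE ij) eqxx.
have Dk : D k = C by rewrite /D ![k == _]eq_sym (negbTE ik) (negbTE jk) eqxx.
have := indX D mD.
have -> : \bigcap_(l in [set: J]) X l @^-1` D l =
          X i @^-1` A `&` X j @^-1` B `&` X k @^-1` C.
  apply/seteqP; split => t /=.
    move=> h; split; first split.
    - by have := h i I; rewrite Di.
    - by have := h j I; rewrite Dj.
    - by have := h k I; rewrite Dk.
  move=> [[hA hB] hC] l _ /=; rewrite /D.
  by case: eqP => [->//|_]; case: eqP => [->//|_]; case: eqP => [->//|_].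
move=> ->.
rewrite (bigD1 i)//= Di (bigD1 j) 1?eq_sym//= Dj (bigD1 k)/=; last first.
  by rewrite ![k == _]eq_sym ik jk.
rewrite Dk big1 ?mule1 ?muleA// => l /andP[/andP[li lj] lk].
rewrite /D (negbTE li) (negbTE lj) (negbTE lk).
by rewrite preimage_setT probability_setT.
Qed.

Lemma mutually_independent2 (i j : J) (A B : set R) :
  mutually_independent X -> i != j -> measurable A -> measurable B ->
  (P (X i @^-1` A `&` X j @^-1` B) = P (X i @^-1` A) * P (X j @^-1` B))%E.
Proof.
move=> indX ij mA mB.
pose D l := if l == i then A else if l == j then B else setT.
have mD l : measurable (D l) by rewrite /D; do 2 case: ifP => // _.
have Di : D i = A by rewrite /D eqxx.
have Dj : D j = B by rewrite /D eq_sym (negbTE ij) eqxx.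
have := indX D mD.
have -> : \bigcap_(l in [set: J]) X l @^-1` D l = X i @^-1` A `&` X j @^-1` B.
  apply/seteqP; split => t /=.
    by move=> h; split; [have := h i I; rewrite Di|have := h j I; rewrite Dj].
  move=> [hA hB] l _ /=; rewrite /D.
  by case: eqP => [->//|_]; case: eqP => [->//|_].
move=> ->; rewrite (bigD1 i)//= Di (bigD1 j) 1?eq_sym//= Dj.
rewrite big1 ?mule1// => l /andP[li lj].
by rewrite /D (negbTE li) (negbTE lj) preimage_setT probability_setT.
Qed.
End Independence.

(** * The law of total variance for conditionally i.i.d. summands *)

Section ConditionallyIid.
Context (R : realType) d (T : measurableType d) (P : probability T R).
Variables (N : nat) (Z : 'I_N.+1 -> {RV P >-> R}).
Variables (g : measurableTypeR R * measurableTypeR R -> R) (M : R).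
Hypothesis hZ : iid_standard_normal Z.
Hypothesis mg : measurable_fun setT g.
Hypothesis gM : forall z, 0 <= g z <= M.
Local Notation gauss := (normal_prob (0 : R) 1).

Let PZ i (A : set R) : measurable A -> P (Z i @^-1` A) = gauss A.
Proof. by move=> mA; case: hZ => _ /(_ i A mA). Qed.

(** In [variance_average], [m] is the mean of [h], [s] the mean of the conditional second moment
    and, by conditional independence, [c] the mean of [h ^+ 2]. Hence [c - m ^+ 2] is the variance
    of [h] and [s - c] the mean conditional variance. *)
Lemma variance_conditionally_iid : (0 < N)%N ->
  let h z := \int[gauss]_x g (z, x) in
  fine 'V_P[(fun t => (2 * N%:R)^-1 *
    \sum_(i < N) g (Z ord0 t, Z (lift ord0 i) t))] =
  4^-1 * ((\int[gauss]_z (h z ^+ 2) - (\int[gauss]_z h z) ^+ 2) +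
    (\int[gauss]_z (\int[gauss]_x (g (z, x) ^+ 2)) -
     \int[gauss]_z (h z ^+ 2)) / N%:R).
Proof.
move=> N0 h; have [indZ _] := hZ.
have mZ i : measurable_fun setT (Z i : T -> measurableTypeR R).
  exact: (measurable_funPT (Z i)).
have g0 z : 0 <= g z by case/andP: (gM z).
have gleM z : g z <= M by case/andP: (gM z).
have pair i : forall A B : set (measurableTypeR R),
    measurable A -> measurable B ->
    P (Z ord0 @^-1` A `&` Z (lift ord0 i) @^-1` B) = (gauss A * gauss B)%E.
  move=> A B mA mB; rewrite mutually_independent2// ?neq_lift//.
  by rewrite !PZ.
apply: (variance_average (M := M)) => //.
- by move=> i; apply: (measurableT_comp mg); exact: measurable_fun_pair.
- move=> i.
  by rewrite (Rintegral_joint (mZ ord0) (mZ (lift ord0 i)) (pair i) mg gM).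
- move=> i.
  rewrite (Rintegral_joint (mZ ord0) (mZ (lift ord0 i)) (pair i)
    (F := fun z => g z ^+ 2) (M := M ^+ 2))//.
    exact: measurable_funX.
  by move=> z; rewrite sqr_ge0/= lerXn2r ?nnegrE// (le_trans (g0 z)).
- move=> i j ij.
  rewrite (Rintegral_cond_indep (mu := gauss) (mZ ord0) (mZ (lift ord0 i))
    (mZ (lift ord0 j)) _ mg gM)// => A B C mA mB mC.
  have lij : lift ord0 i != lift ord0 j by rewrite (inj_eq lift_inj).
  rewrite mutually_independent3// ?neq_lift//.
  by rewrite !PZ.
Qed.
End ConditionallyIid.

(** * The power conditional on the common factor *)

Section ConditionalPower.
Variables (R : realType) (alpha rho gamma : R) (q : R -> R).
Hypothesis rho_bounds : 0 < rho < 1.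
Hypothesis gamma_gt0 : 0 < gamma.
Hypothesis hq : quantile_equation alpha rho gamma q.
Local Notation gauss := (normal_prob (0 : R) 1).
Let r := Num.sqrt rho.
Let s := Num.sqrt (1 - rho).

Let r_gt0 : 0 < r. Proof. by rewrite sqrtr_gt0; case/andP: rho_bounds. Qed.
Let s_gt0 : 0 < s.
Proof. by rewrite sqrtr_gt0 subr_gt0; case/andP: rho_bounds. Qed.

(* [pair_beats (Z_0, Z_i)] is [I_i + I_i^m].  The library puts the measure
   [normal_prob] on [measurableTypeR R], hence the type annotations. *)
Definition pair_beats (z : measurableTypeR R * measurableTypeR R) : R :=
  (q z.1 < r * z.1 + s * z.2 + gamma)%R%:R +
  (q z.1 < - (r * z.1) - s * z.2 + gamma)%R%:R.

Lemma pair_beats_bounds z : 0 <= pair_beats z <= 2.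
Proof.
rewrite /pair_beats; do 2 case: (_ < _)%R => /=; lra.
Qed.

(** The left side of the quantile equation is strictly decreasing in the quantile, so the position
    of [q z] relative to [y] is read off from its value at [y]. *)
Lemma quantile_lt z y : (q z < y) =
  (Phi ((r * z + rho * gamma - y) / s) +
   Phi (- ((r * z + rho * gamma + y) / s)) < 2 * alpha).
Proof.
have mono a b : a < b ->
    Phi ((r * z + rho * gamma - b) / s) +
    Phi (- ((r * z + rho * gamma + b) / s)) <
    Phi ((r * z + rho * gamma - a) / s) +
    Phi (- ((r * z + rho * gamma + a) / s)).
  move=> ab; apply: ltrD; rewrite ltr_Phi ?ltrN2 ltr_pM2r ?invr_gt0//.
    by rewrite ltrD2l ltrN2.
  by rewrite ltrD2l.
have := hq z; rewrite -/r -/s => e.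
have [qy|yq|<-] := ltgtP (q z) y.
- by rewrite -e mono.
- by apply/esym/negbTE; rewrite -leNgt -e ltW// mono.
- by rewrite e ltxx.
Qed.

(** Although [q] is only given implicitly, [quantile_lt] turns the preimages of open left rays into
    sublevel sets of an explicit measurable function. *)
Lemma measurable_quantile : measurable_fun setT q.
Proof.
apply: (measurability _ (RGenInftyO.measurableE R)) => _ [_ [y ->] <-].
have mPhi (f : R -> R) :
    measurable_fun setT f -> measurable_fun setT (@Phi R \o f).
  move=> mf; apply: measurableT_comp => //.
  by apply: nondecreasing_measurable => // a b; rewrite ler_Phi.
pose F z := Phi ((r * z + rho * gamma - y) / s) +
            Phi (- ((r * z + rho * gamma + y) / s)).
have mF : measurable_fun setT F.
  have maff : measurable_fun setT (fun z => r * z + rho * gamma).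
    by apply: measurable_funD => //; exact: measurable_funM.
  apply: measurable_funD.
    apply: (mPhi (fun z => (r * z + rho * gamma - y) / s)).
    by apply: measurable_funM => //; exact: measurable_funB.
  apply: (mPhi (fun z => - ((r * z + rho * gamma + y) / s))).
  apply: measurableT_comp => //.
  by apply: measurable_funM => //; exact: measurable_funD.
rewrite (_ : _ `&` _ = setT `&` F @^-1` `]-oo, 2 * alpha[); first exact: mF.
by congr (_ `&` _); apply/seteqP; split => z /=; rewrite !in_itv/= quantile_lt.
Qed.

Lemma measurable_pair_beats : measurable_fun setT pair_beats.
Proof.
pose RR := (measurableTypeR R * measurableTypeR R)%type.
have mq1 : measurable_fun setT (fun z : RR => q z.1).
  by apply: measurableT_comp => //; exact: measurable_quantile.
have mlt (f : RR -> R) : measurable_fun setT f ->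
    measurable_fun setT (fun z => (q z.1 < f z)%R%:R : R).
  move=> mf; rewrite (_ : (fun z => _) = fun z => if q z.1 < f z then 1 else 0).
    by apply: measurable_fun_ifT => //; exact: measurable_fun_ltr.
  by apply/funext => z; case: (_ < _).
have m1 : measurable_fun setT (fun z : RR => r * z.1).
  by apply: measurable_funM => //; exact: measurable_fst.
have m2 : measurable_fun setT (fun z : RR => s * z.2).
  by apply: measurable_funM => //; exact: measurable_snd.
apply: measurable_funD; apply: mlt.
  by apply: measurable_funD => //; exact: measurable_funD.
apply: measurable_funD => //; apply: measurable_funB => //.
exact: measurableT_comp.
Qed.

(** Thresholds for the specific factor: the estimator succeeds above [A z], its mirror below
    [B z]. *)
Let A z := (q z - r * z - gamma) / s.
Let B z := (gamma - q z - r * z) / s.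

Let beats_itv z x : (q z < r * z + s * x + gamma) = (A z < x).
Proof. rewrite /A ltr_pdivrMr//. by apply/idP/idP => ?; lra. Qed.

Let mirror_itv z x : (q z < - (r * z) - s * x + gamma) = (x < B z).
Proof. rewrite /B ltr_pdivlMr//. by apply/idP/idP => ?; lra. Qed.

(** This is [h z], for [g] equal to [pair_beats]. *)
Definition cond_power z := \int[gauss]_x pair_beats (z, x).

Let Rintegral_pred (p : R -> bool) (E : set (measurableTypeR R)) :
  measurable E -> (forall x, p x = (x \in E)) ->
  gauss.-integrable setT (EFin \o (fun x => (p x)%:R)) /\
  \int[gauss]_x (p x)%:R = fine (gauss E).
Proof.
move=> mE pE; have -> : (fun x => (p x)%:R) = \1_E :> (_ -> R).
  by apply/funext => x; rewrite indicE pE.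
split; last by rewrite /Rintegral integral_indic// setIT.
apply: (@bounded_integrable _ _ _ _ _ 1) => [|x]; first exact: measurable_indic.
by rewrite indicE; case: (_ \in _); rewrite /= ?normr1 ?normr0.
Qed.

(** The two summands are indicators of the half-lines above [A z] and below [B z], of masses
    [Phi (- A z)] and [Phi (B z)]. *)
Lemma cond_powerE z : cond_power z =
  Phi ((r * z + gamma - q z) / s) + Phi ((- (r * z) + gamma - q z) / s).
Proof.
rewrite /cond_power /pair_beats /=.
have [|x|i1 e1] :=
  @Rintegral_pred (fun x => q z < r * z + s * x + gamma) `]A z, +oo[ => //.
  by rewrite beats_itv mem_setE in_itv/= andbT.
have [|x|i2 e2] :=
  @Rintegral_pred (fun x => q z < - (r * z) - s * x + gamma) `]-oo, B z[ => //.
  by rewrite mirror_itv mem_setE in_itv.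
rewrite RintegralD// e1 e2 normal_prob_itvoy normal_prob_itvNyo /=.
congr (Phi _ + Phi _); rewrite /A /B; field; exact: lt0r_neq0.
Qed.

Lemma cond_power_bounds z : 0 <= cond_power z <= 2.
Proof.
apply: Rintegral_le_cst => [|x]; last exact: pair_beats_bounds.
by apply: measurableT_comp => //; exact: measurable_pair_beats.
Qed.

Lemma measurable_cond_power :
  measurable_fun setT (cond_power : measurableTypeR R -> R).
Proof.
exact: (measurable_Rintegral_section gauss measurable_pair_beats
  pair_beats_bounds).
Qed.

(** [u z] and [v z] are the two arguments of [Phi] in the quantile equation. The conditional power
    has the same form with shifted arguments; the shifts differ because [gamma] enters both
    estimators with the same sign, whereas [rho * gamma] enters [u] and [v] with opposite signs. *)
Let a z := r * z + rho * gamma.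
Let u z := (a z - q z) / s.
Let v z := (- a z - q z) / s.

Let vE z : v z = u z - 2 * a z / s.
Proof. rewrite /u /v; field; exact: lt0r_neq0. Qed.

Let cond_power_uv z : cond_power z =
  Phi (u z + (1 - rho) * gamma / s) + Phi (v z + (1 + rho) * gamma / s).
Proof.
rewrite cond_powerE /u /v /a; congr (Phi _ + Phi _); field; exact: lt0r_neq0.
Qed.

Let rgs_gt0 : 0 < rho * gamma / s.
Proof. by rewrite divr_gt0// mulr_gt0//; case/andP: rho_bounds. Qed.

(** * Behaviour of the conditional power far from the origin *)

Section Tails.
Variable t : R.
Hypothesis tE : Phi t = 2 * alpha.

Let uvE z : Phi (u z) + Phi (v z) = Phi t.
Proof.
rewrite tE -(hq z) -/r -/s -/(a z); congr (_ + Phi _).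
by rewrite /v -mulNr [- (a z + q z)]opprD.
Qed.

(** The other summand of [Phi t] is positive. *)
Let u_lt z : u z < t.
Proof. by rewrite -ltr_Phi -(uvE z) ltrDl Phi_gt0. Qed.

Let v_lt z : v z < t.
Proof. by rewrite -ltr_Phi -(uvE z) ltrDr Phi_gt0. Qed.

Let exists_Phi_lt (e : R) : 0 < e -> exists y, Phi y < e.
Proof.
move=> e0; have /filter_ex[y /= ye] : \forall y \near -oo, Phi y < e.
  exact: cvgr_lt (@cvg_Phi_ninfty R) _ e0.
by exists y.
Qed.

(* As [z] tends to +oo, [v z] tends to -oo and the power to
   [Phi (t + (1 - rho) * gamma / s)]. *)
Lemma cond_power_right :
  exists K, forall z : R, K < z -> cond_power z < Phi (t + gamma / s).
Proof.
(* The level [Phi (t + gamma / s)] lies strictly between the two tail limits; this gap is the room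
   left for the vanishing summand. *)
have e0 : 0 < Phi (t + gamma / s) - Phi (t + (1 - rho) * gamma / s).
  rewrite subr_gt0 ltr_Phi; have := rgs_gt0; lra.
have [y ye] := exists_Phi_lt e0.
(* Solves [2 * a z / s = t + (1 + rho) * gamma / s - y] for [z]; beyond it [vE] and [u_lt] push the
   second argument below [y]. *)
exists (((t + (1 + rho) * gamma / s - y) * s / 2 - rho * gamma) / r) => z.
rewrite ltr_pdivrMr// ltrBlDr [_ * r]mulrC -/(a z) ltr_pdivrMr// => za.
rewrite cond_power_uv.
have h1 : Phi (u z + (1 - rho) * gamma / s) < Phi (t + (1 - rho) * gamma / s).
  by rewrite ltr_Phi ltrD2r.
have h2 : Phi (v z + (1 + rho) * gamma / s) < Phi y.
  rewrite ltr_Phi vE; have := u_lt z.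
  have : t + (1 + rho) * gamma / s - y < 2 * a z / s.
    by rewrite ltr_pdivlMr// [2 * _]mulrC.
  lra.
lra.
Qed.

(* As [z] tends to -oo, [u z] tends to -oo and the power to
   [Phi (t + (1 + rho) * gamma / s)]. *)
Lemma cond_power_left :
  exists K, forall z : R, z < K -> Phi (t + gamma / s) <= cond_power z.
Proof.
(* If [Phi (u z)] is below this gap, then [v z] exceeds [t - rho * gamma / s], so the second
   argument of the power exceeds [t + gamma / s]. *)
have e0 : 0 < Phi t - Phi (t - rho * gamma / s).
  rewrite subr_gt0 ltr_Phi; have := rgs_gt0; lra.
have [y ye] := exists_Phi_lt e0.
(* Solves [2 * a z / s = y - t]; to its left [u z = v z + 2 * a z / s] is below [y]. *)
exists (((y - t) * s / 2 - rho * gamma) / r) => z.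
rewrite ltr_pdivlMr// ltrBrDr [_ * r]mulrC -/(a z) ltr_pdivlMr// => za.
have h1 : Phi (u z) < Phi y.
  rewrite ltr_Phi; have := vE z; have := v_lt z.
  have : 2 * a z / s < y - t by rewrite ltr_pdivrMr// [2 * _]mulrC.
  lra.
have : Phi (t - rho * gamma / s) < Phi (v z) by have := uvE z; lra.
rewrite ltr_Phi => vt; rewrite cond_power_uv.
apply: (@le_trans _ _ (Phi (v z + (1 + rho) * gamma / s))).
  by rewrite ler_Phi; lra.
by rewrite lerDr ltW// Phi_gt0.
Qed.

(* Once [q z] exceeds [gamma], both estimators fail on the interval [B z, A z],
   whereas one of them succeeds outside it. *)
Lemma cond_variance_right : exists K, forall z : R, K < z ->
  0 < \int[gauss]_x (pair_beats (z, x) ^+ 2) - cond_power z ^+ 2.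
Proof.
(* Chosen so that [a z > gamma + s * t]; since [u z < t], this gives [q z > a z - s * t > gamma]. *)
exists ((gamma + s * t - rho * gamma) / r) => z.
rewrite ltr_pdivrMr// ltrBlDr [_ * r]mulrC -/(a z) => za.
have gq : gamma < q z.
  have := u_lt z; rewrite /u ltr_pdivrMr// mulrC; lra.
have BA : B z < A z.
  by rewrite /B /A ltr_pM2r ?invr_gt0//; lra.
(* The level 1 separates the value 0 on the first interval from values at least 1 on the second. *)
apply: (variance_gt0 (P := gauss) (f := fun x => pair_beats (z, x))
  (M := 2) (k := 1) (A := `]B z, A z]) (B := `]A z, A z + 1])) => //.
- by apply: measurableT_comp => //; exact: measurable_pair_beats.
- by move=> x; exact: pair_beats_bounds.
- exact: normal_prob_itv_gt0.
- move=> x /=; rewrite in_itv/= => /andP[Bx xA].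
  rewrite /pair_beats/= beats_itv mirror_itv (le_gtF xA).
  by rewrite (le_gtF (ltW Bx)) addr0.
- by apply: normal_prob_itv_gt0; rewrite ltrDl.
- move=> x /=; rewrite in_itv/= => /andP[Ax _].
  by rewrite /pair_beats/= beats_itv Ax lerDl.
Qed.

(** Each tail contains an interval of positive mass, and the conditional power lies on opposite
    sides of [Phi (t + gamma / s)] on the two. *)
Lemma variance_cond_power_gt0 :
  0 < \int[gauss]_z (cond_power z ^+ 2) - (\int[gauss]_z cond_power z) ^+ 2.
Proof.
have [K hK] := cond_power_right; have [L hL] := cond_power_left.
apply: (variance_gt0 (P := gauss) (M := 2) (k := Phi (t + gamma / s))
  (A := `]K, K + 1]) (B := `]L - 2, L - 1])) => //.
- exact: measurable_cond_power.
- exact: cond_power_bounds.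
- by apply: normal_prob_itv_gt0; rewrite ltrDl.
- by move=> x /=; rewrite in_itv/= => /andP[Kx _]; exact: hK.
- by apply: normal_prob_itv_gt0; lra.
- by move=> x /=; rewrite in_itv/= => /andP[_ Lx]; apply: hL; lra.
Qed.

(** The difference is the integral of the conditional variance, which is nonnegative by its centred
    form and positive on []K, K + 1]]. The bounds 4 come from [pair_beats] being at most 2. *)
Lemma mean_cond_variance_gt0 :
  0 < \int[gauss]_z (\int[gauss]_x (pair_beats (z, x) ^+ 2)) -
      \int[gauss]_z (cond_power z ^+ 2).
Proof.
have [K hK] := cond_variance_right.
have mpb z : measurable_fun setT (fun x => pair_beats (z, x)).
  by apply: measurableT_comp => //; exact: measurable_pair_beats.
have mpb2 : measurable_fun setT (fun z => pair_beats z ^+ 2).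
  by apply: measurable_funX; exact: measurable_pair_beats.
have pb2 z : 0 <= pair_beats z ^+ 2 <= 4.
  by have /andP[? ?] := pair_beats_bounds z; rewrite sqr_ge0/= expr2; nra.
have cp2 z : 0 <= cond_power z ^+ 2 <= 4.
  by have /andP[? ?] := cond_power_bounds z; rewrite sqr_ge0/= expr2; nra.
have mcp2 :
    measurable_fun setT (fun z : measurableTypeR R => cond_power z ^+ 2).
  by apply: measurable_funX; exact: measurable_cond_power.
have mg2 := measurable_Rintegral_section gauss mpb2 pb2.
have g2 z : 0 <= \int[gauss]_x (pair_beats (z, x) ^+ 2) <= 4.
  by apply: Rintegral_le_cst => [|x]; [exact: measurable_funX|exact: pb2].
rewrite -RintegralB//; last 2 first.
- apply: (@bounded_integrable _ _ _ _ _ 4) => // z.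
  by have /andP[? ?] := g2 z; rewrite ger0_norm.
- apply: (@bounded_integrable _ _ _ _ _ 4) => // z.
  by have /andP[? ?] := cp2 z; rewrite ger0_norm.
apply: (Rintegral_gt0 (P := gauss) (M := 4) (A := `]K, K + 1])
  (f := fun z =>
    \int[gauss]_x (pair_beats (z, x) ^+ 2) - cond_power z ^+ 2)) => //.
- exact: measurable_funB.
- move=> z; apply/andP; split; last first.
    by have := g2 z; have := cp2 z; lra.
  rewrite -(Rintegral_sqr_center gauss (mpb z)
    (fun x => pair_beats_bounds (z, x))).
  by apply: Rintegral_ge0 => x _; exact: sqr_ge0.
- by apply: normal_prob_itv_gt0; rewrite ltrDl.
- by move=> z /=; rewrite in_itv/= => /andP[Kz _]; exact: hK.
Qed.
End Tails.
End ConditionalPower.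

(** * Monotonicity and limit of the standard error *)

Theorem theoremA5 (R : realType) (n : nat) (alpha beta rho gamma : R)
    (q : R -> R)
    (d : nat -> measure_display)
    (T : forall N : nat, measurableType (d N))
    (P : forall N : nat, probability (T N) R)
    (Z : forall N : nat, 'I_N.+1 -> {RV (P N) >-> R})
    (hn : (0 < n)%N)
    (halpha : 0 < alpha < 1 / 2)
    (hbeta : 0 < beta)
    (hgamma : gamma = Num.sqrt n%:R * beta)
    (hrho : 0 < rho < 1)
    (hq : quantile_equation alpha rho gamma q)
    (hZ : forall N : nat, iid_standard_normal (Z N)) :
  let SE := fun N : nat =>
    std_error (P N) (power rho gamma q (fun i => Z N i : T N -> R)) in
  (forall N N' : nat, attainable alpha N -> attainable alpha N' ->
     (N < N')%N -> SE N' < SE N) /\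
  (exists c : R, c != 0 /\
     SE N @[N --> within (attainable alpha) \oo] --> c).
Proof.
move=> SE.
have gamma_gt0 : 0 < gamma by rewrite hgamma mulr_gt0// sqrtr_gt0 ltr0n.
have [t tE] : exists t, Phi t = 2 * alpha.
  by apply: Phi_surj; case/andP: halpha; lra.
have := variance_cond_power_gt0 hrho gamma_gt0 hq tE.
have := mean_cond_variance_gt0 hrho hq tE.
(* [D] is the variance of the conditional power and [C] the mean conditional variance. *)
set D := (X in _ -> 0 < X -> _); set C := (X in 0 < X -> _) => C0 D0.
have SEE N : (0 < N)%N -> SE N = Num.sqrt (4^-1 * (D + C / N%:R)).
  move=> N0; congr Num.sqrt.
  exact: (variance_conditionally_iid (hZ N) (measurable_pair_beats hrho hq)
    (pair_beats_bounds rho gamma q) N0).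
split.
  move=> N N' [N0 _] [N'0 _] NN'; rewrite !SEE// ltr_sqrt.
    rewrite ltr_pM2l ?invr_gt0// ltrD2l ltr_pM2l//.
    by rewrite ltf_pV2 ?posrE ?ltr0n// ltr_nat.
  by rewrite mulr_gt0 ?invr_gt0// addr_gt0// divr_gt0// ltr0n.
(* The limit is half the standard deviation of the conditional power, nonzero because [D > 0]. *)
exists (Num.sqrt (4^-1 * D)); split.
  by rewrite gt_eqF// sqrtr_gt0 mulr_gt0// invr_gt0.
apply: cvg_within_filter.
have inv0 : (N%:R : R)^-1 @[N --> \oo] --> (0 : R).
  apply/gtr0_cvgV0; last exact: cvgr_idn.
  by near=> N; rewrite ltr0n; near: N; exact: nbhs_infty_gt.
have lim0 : 4^-1 * (D + C / N%:R) @[N --> \oo] --> 4^-1 * D.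
  rewrite -{2}[D]addr0 -[X in D + X](mulr0 C).
  by apply: cvgMl_tmp; apply: cvgD; [exact: cvg_cst|exact: cvgMl_tmp].
have lim :
    Num.sqrt (4^-1 * (D + C / N%:R)) @[N --> \oo] --> Num.sqrt (4^-1 * D).
  exact: (cvg_comp _ _ lim0 (@sqrt_continuous R _)).
(* The closed form [SEE] is available from [N = 1] on, so the two sequences agree eventually. *)
apply: cvg_trans lim; apply: near_eq_cvg; near=> N.
by rewrite SEE//; near: N; exact: nbhs_infty_gt.
Unshelve. all: end_near. Qed.
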